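(* Let $q\geq 3$ and let $d$ be an even positive integer. Then $\chi(T_q,d)\leq (q-1)(d+1)$.
   Context: $T_q$ is the infinite $q$-regular tree, viewed as a metric space on its vertex set where each edge has length $1$ (so the distance is the combinatorial graph distance). For $d>0$, $\chi(T_q,d)$ is the minimal number of colors needed to color the vertices of $T_q$ so that any two vertices at distance exactly $d$ receive different colors. *)

(* Defs.v *)
From mathcomp Require Import all_boot.
Set Implicit Arguments.
Unset Strict Implicit.
Unset Printing Implicit Defensive.

Section InfiniteGraphs.

Variables (V : eqType) (e : rel V).

Definition simple_graph : Prop := symmetric e /\ irreflexive e.

Definition connected_graph : Prop :=
  inhabited V /\ forall x y : V, exists2 p : seq V, path e x p & last x p = y.

(* [ucycle e [:: x; y]] holds as soon as x and y are adjacent, so only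
   duplicate-free cyclic sequences with at least 3 vertices are graph cycles. *)
Definition acyclic_graph : Prop := forall c : seq V, ucycle e c -> size c < 3.

Definition regular_graph (q : nat) : Prop :=
  forall x : V, exists s : seq V, [/\ uniq s, size s = q & forall y, (y \in s) = e x y].

(* For q >= 2 such a graph is necessarily infinite, and it is unique up to
   isomorphism: it is T_q. *)
Definition regular_tree (q : nat) : Prop :=
  [/\ simple_graph, connected_graph, acyclic_graph & regular_graph q].

Definition walk (x y : V) (n : nat) : Prop :=
  exists p : seq V, [/\ path e x p, last x p = y & size p = n].

Definition at_distance (x y : V) (d : nat) : Prop :=
  walk x y d /\ forall n : nat, walk x y n -> d <= n.

Definition distance_colorable (d k : nat) : Prop :=
  exists c : V -> 'I_k, forall x y : V, at_distance x y d -> c x <> c y.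

(* Relational form of "chi(V, d) = k", so that no junk value is needed when
   finitely many colors do not suffice. *)
Definition is_distance_chromatic_number (d k : nat) : Prop :=
  distance_colorable d k /\ forall n : nat, distance_colorable d n -> k <= n.

End InfiniteGraphs.

(* Main.v *)
Require Import Defs.
From mathcomp Require Import all_boot.
From mathcomp Require Import zify boolp.

(** Write [d = 2k] and root the tree at a vertex. A geodesic of length [d] first
    climbs [i] steps to the last common ancestor and then descends [d - i]
    steps, so its endpoints have depths of equal parity differing by at most
    [d]: the colour [h./2 %% k.+1] of the depth [h] separates endpoints of
    different depths. Endpoints of equal depth have the same [k]-th ancestor but
    distinct [(k-1)]-st ancestors, so they are separated by the rank of the
    [(k-1)]-st ancestor among its siblings. This takes [q - 1] labels, except
    when the [k]-th ancestor is the root, where there are [q] siblings; the last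
    of them gets one additional colour. In total
    [(k + 1) (q - 1) + 1 <= (q - 1) (d + 1)] colours suffice. *)

Lemma ex_least (P : nat -> Prop) :
  (exists n, P n) -> exists2 n, P n & forall m, P m -> n <= m.
Proof.
move=> [n Pn].
have exP : exists n, (fun m => `[< P m >]) n by exists n; apply/asboolP.
case: (ex_minnP exP) => m /asboolP Pm minm; exists m => // j Pj.
by apply: minm; apply/asboolP.
Qed.

(** Depth [h] and parent map [p]; at depth 0 the value of [p] is arbitrary. The second clause
    carries acyclicity to the colouring. *)
Definition rooting {V : eqType} (e : rel V) (h : V -> nat) (p : V -> V) : Prop :=
  (forall x, 0 < h x -> e x (p x) /\ h x = (h (p x)).+1) /\
  (forall x y, e x y -> (0 < h x /\ y = p x) \/ (0 < h y /\ x = p y)).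

Section Walks.

Variables (V : eqType) (e : rel V).

Lemma walk_rcons x y z n : walk e x y n -> e y z -> walk e x z n.+1.
Proof.
move=> [s [ps ls <-]] eyz; exists (rcons s z).
by rewrite rcons_path ps ls eyz last_rcons size_rcons.
Qed.

Lemma walk_cat x y z m n : walk e x y m -> walk e y z n -> walk e x z (m + n).
Proof.
move=> [s [ps ls <-]] [t [pt lt <-]]; exists (s ++ t).
by rewrite cat_path ps ls pt last_cat ls lt size_cat.
Qed.

Lemma walk_sym x y n : symmetric e -> walk e x y n -> walk e y x n.
Proof.
move=> symE [s [ps <- <-]]; exists (rev (belast x s)); split.
- by rewrite rev_path (eq_path (e' := e)) // => u v; rewrite symE.
- by case: s ps => //= a s _; rewrite rev_cons last_rcons.
- by rewrite size_rev size_belast.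
Qed.

End Walks.

(** * Depth and parents in an acyclic graph *)

Section Depth.

Variables (V : eqType) (e : rel V) (r : V) (h : V -> nat) (p : V -> V).
Hypotheses (symE : symmetric e) (irrE : irreflexive e).
Hypothesis acyc : acyclic_graph e.
Hypothesis h_dist : forall x, at_distance e r x (h x).
Hypothesis p_step : forall x, 0 < h x -> e x (p x) /\ h x = (h (p x)).+1.

Lemma depth0 x : h x = 0 -> x = r.
Proof.
move=> hx; have [[s [_ ls sz]] _] := h_dist x.
by rewrite hx in sz; rewrite -ls (size0nil sz).
Qed.

Lemma depth_edge x y : e x y -> h y <= (h x).+1.
Proof.
by move=> exy; have [wx _] := h_dist x; apply: (h_dist y).2; apply: walk_rcons exy.
Qed.

(* The path is prolonged at both ends by the parents of its endpoints, until
   these coincide and close a cycle. *)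
Lemma no_detour n x s : h x = n -> h (last x s) = n -> x != last x s ->
  path e x s -> uniq (x :: s) -> all (fun z => n <= h z) (x :: s) -> False.
Proof.
elim: n x s => [|n IH] x s hx hy neq ps us al.
  by rewrite (depth0 _ hy) (depth0 _ hx) eqxx in neq.
have [ex hpx] : e x (p x) /\ h x = (h (p x)).+1 by apply: p_step; rewrite hx.
set y := last x s in hy neq.
have [ey hpy] : e y (p y) /\ h y = (h (p y)).+1 by apply: p_step; rewrite hy.
have hpx' : h (p x) = n by lia.
have hpy' : h (p y) = n by lia.
have notin z : h z = n -> z \notin x :: s.
  by move=> hz; apply/negP => /(allP al); rewrite hz ltnn.
have [eqp|neqp] := eqVneq (p x) (p y).
  suff /acyc : ucycle e [:: p x, x & s].
    by case: s @y neq {IH ps us al notin ey hy hpy hpy' eqp} => //=; rewrite eqxx.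
  rewrite /ucycle /cycle rcons_path /= -/y symE ex ps eqp ey /= -eqp.
  by rewrite notin //=; move: us => /= ->.
apply: (IH (p x) (x :: rcons s (p y))) => //=.
- by rewrite last_rcons.
- by rewrite last_rcons.
- by rewrite symE ex rcons_path ps.
- have := notin _ hpx'; have := notin _ hpy'; move: us => /=.
  rewrite !inE !mem_rcons rcons_uniq !inE !negb_or neqp (eq_sym x (p y)).
  by do 2!case/andP=> -> ->; case/andP=> -> ->.
- rewrite hpx' leqnn hx leqnSn /= all_rcons hpy' leqnn /=.
  by apply/allP => z zs; apply: ltnW; apply: (allP al); rewrite inE zs orbT.
Qed.

(** Otherwise [no_detour] is violated, by the edge itself when the depths agree, or by the path [y],
    [x], [p x] one level up. *)
Lemma parent_edge x y : e x y -> h y <= h x -> 0 < h x /\ y = p x.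
Proof.
move=> exy; rewrite leq_eqVlt => /orP [/eqP hxy|lt].
  have neq : x != y by apply/eqP => xy; move: exy; rewrite xy irrE.
  by case: (@no_detour (h x) x [:: y]); rewrite //= ?exy ?inE ?neq ?hxy ?leqnn.
have hx : 0 < h x by lia.
split=> //; apply/eqP/negPn/negP => neq.
have [ex hpx] := p_step _ hx.
have hy : h x = (h y).+1.
  by apply/eqP; rewrite eqn_leq lt andbT; apply: depth_edge; rewrite symE.
have yx : y != x by apply/eqP => yx; move: lt; rewrite yx ltnn.
have xp : x != p x by apply/eqP => xp; move: hpx; rewrite -xp; lia.
case: (@no_detour (h y) y [:: x; p x]) => //=.
- by lia.
- by rewrite symE exy ex.
- by rewrite !inE negb_or yx neq xp.
- by rewrite leqnn (ltnW lt) andbT; lia.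
Qed.

End Depth.

Lemma rooting_exists (V : eqType) (e : rel V) :
  simple_graph e -> connected_graph e -> acyclic_graph e ->
  exists h p, rooting e h p.
Proof.
move=> [symE irrE] [[r] conn] acyc.
have /choice [h h_dist] : forall x, exists n, at_distance e r x n.
  move=> x; have /ex_least [n wn minn] : exists n, walk e r x n.
    by have [s ps ls] := conn r x; exists (size s), s.
  by exists n.
have /choice [p p_step] : forall x, exists y, 0 < h x -> e x y /\ h x = (h y).+1.
  move=> x; have [[s [ps ls sz]] _] := h_dist x.
  (* The parent is the last but one vertex of a shortest walk from the root. *)
  case: (lastP s) ps ls sz => [|t z]; first by move=> _ _ <-; exists x.
  rewrite rcons_path last_rcons size_rcons => /andP[pt et] zx ht.
  subst z; exists (last r t) => _; split; first by rewrite symE.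
  have wt : walk e r (last r t) (size t) by exists t.
  have le1 := (h_dist (last r t)).2 _ wt.
  have := depth_edge _ _ _ _ h_dist _ _ et; lia.
exists h, p; split=> // x y exy.
have [le|/ltnW le] := leqP (h y) (h x).
  by left; apply: (parent_edge _ _ _ _ _ symE irrE acyc h_dist).
right; apply: (parent_edge _ _ _ _ _ symE irrE acyc h_dist p_step) => //.
by rewrite symE.
Qed.

(** * Walks and common ancestors *)

Section Rooted.

Variables (V : eqType) (e : rel V) (h : V -> nat) (p : V -> V).
Hypotheses (symE : symmetric e) (root_hp : rooting e h p).

Lemma depth_iter n x : n <= h x -> h (iter n p x) = h x - n.
Proof.
elim: n => [|n IH] lt /=; first by rewrite subn0.
have hn := IH (ltnW lt).
have [|_ hp] := root_hp.1 (iter n p x); first by lia.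
by lia.
Qed.

Lemma walk_iter n x : n <= h x -> walk e x (iter n p x) n.
Proof.
elim: n => [|n IH] lt; first by exists [::].
apply: walk_rcons (IH (ltnW lt)) _.
by have [] // := root_hp.1 (iter n p x); rewrite depth_iter ?subn_gt0 // ltnW.
Qed.

Lemma meet_walk i j x y :
  i <= h x -> j <= h y -> iter i p x = iter j p y -> walk e x y (i + j).
Proof.
move=> ix jy eqij; apply: walk_cat (walk_iter _ _ ix) _.
by rewrite eqij; apply: walk_sym symE _; apply: walk_iter.
Qed.

Lemma walk_meet n x y : walk e x y n -> exists i j,
  [/\ i + j <= n, i <= h x, j <= h y & iter i p x = iter j p y].
Proof.
move=> [s [ps <- <-]]; elim: s x ps => [|z s IH] x /=; first by exists 0, 0.
case/andP=> exz /IH [i [j [ij iz jy eqij]]].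
case: (root_hp.2 _ _ exz) => [[hx zE]|[hz xE]].
  have [_ hx'] := root_hp.1 _ hx.
  exists i.+1, j; split=> //; first by rewrite hx' -zE.
  by rewrite iterSr -zE.
have [_ hz'] := root_hp.1 _ hz.
(* The walk first descends from [x] to [z]. If the climb from [z] is nonempty it passes through [x],
   which saves a step; otherwise [z] is the meeting point and [x], its parent, replaces it. *)
case: i ij iz eqij => [|i] ij iz eqij; last first.
  exists i, j; split=> //; [by lia|by rewrite xE; lia|].
  by rewrite xE -iterSr.
exists 0, j.+1; split=> //.
  by have := depth_iter _ _ jy; rewrite -eqij /=; lia.
by rewrite /= -eqij.
Qed.

Lemma distance_meet d x y : at_distance e x y d -> exists i j,
  [/\ i + j = d, i <= h x, j <= h y & iter i p x = iter j p y].
Proof.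
move=> [/walk_meet [i [j [ij ix jy eqij]]] mind]; exists i, j; split=> //.
by apply/eqP; rewrite eqn_leq ij; apply: mind; apply: meet_walk.
Qed.

(** * Ranks among siblings *)

Variables (q : nat) (nb : V -> seq V).
Hypothesis nb_spec :
  forall x, [/\ uniq (nb x), size (nb x) = q & forall y, (y \in nb x) = e x y].

(* Removing the grandparent from the neighbours of the parent leaves [q - 1]
   siblings; a parent at depth 0 has no parent itself to remove. *)
Definition siblings (x : V) : seq V :=
  if h x <= 1 then nb (p x) else rem (p (p x)) (nb (p x)).

Definition sibling_rank (x : V) : nat := index x (siblings x).

Lemma mem_siblings x : 0 < h x -> x \in siblings x.
Proof.
move=> hx; have [ex hpx] := root_hp.1 _ hx.
have [un _ mem] := nb_spec (p x).
rewrite /siblings; case: leqP => lt; first by rewrite mem symE.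
rewrite mem_rem_uniq // !inE mem symE ex andbT.
have [|_ hppx] := root_hp.1 (p x); first by lia.
by apply/eqP => xE; move: hpx; rewrite [in h x]xE; lia.
Qed.

Lemma sibling_rank_lt x : 0 < h x -> sibling_rank x < q - (1 < h x).
Proof.
move=> hx; have := mem_siblings _ hx; rewrite -index_mem => lt.
apply: leq_trans lt _; have [_ sz mem] := nb_spec (p x).
rewrite /siblings; case: (leqP (h x) 1) => lt1 /=; first by rewrite sz subn0.
have [_ hpx] := root_hp.1 _ hx; have [|epx _] := root_hp.1 (p x); first by lia.
by rewrite size_rem ?mem // sz subn1.
Qed.

Lemma sibling_rank_inj x y : 0 < h x -> h x = h y -> p x = p y ->
  sibling_rank x = sibling_rank y -> x = y.
Proof.
move=> hx hxy pxy.
have sE : siblings x = siblings y by rewrite /siblings hxy pxy.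
have xs := mem_siblings _ hx; have ys : y \in siblings x.
  by rewrite sE mem_siblings -?hxy.
rewrite /sibling_rank -sE => eqi.
by rewrite -(nth_index x xs) eqi nth_index.
Qed.

(** * The colouring *)

Variable k : nat.
Hypotheses (k_gt0 : 0 < k) (q_gt2 : 2 < q).

(** Above depth [k] no vertex of equal depth is at distance [2k], so any label below [q.-1] would do
    there. *)
Definition rank_label (x : V) : nat :=
  if h x < k then 0 else sibling_rank (iter k.-1 p x).

(** The pair of residue and label is packed in base [q.-1]; the exceptional label gets the first
    number past all pairs. *)
Definition tree_color (x : V) : nat :=
  if rank_label x < q.-1 then (h x)./2 %% k.+1 * q.-1 + rank_label x
  else k.+1 * q.-1.

(** Rank [q.-1] requires [q] siblings, so the ancestor being ranked lies at depth 1. *)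
Lemma rank_label_max x : q.-1 <= rank_label x -> rank_label x = q.-1 /\ h x = k.
Proof.
rewrite /rank_label; case: ltnP => [|le]; first by lia.
have hk : h (iter k.-1 p x) = h x - k.-1 by apply: depth_iter; lia.
have := @sibling_rank_lt (iter k.-1 p x); rewrite hk => /(_ ltac:(lia)).
by case: ltnP => /=; lia.
Qed.

Lemma tree_color_lt x : tree_color x < k.+1 * q.-1 + 1.
Proof.
rewrite /tree_color; case: (ltnP (rank_label x)) => lt; last by lia.
have := ltn_pmod (h x)./2 (ltn0Sn k); nia.
Qed.

(** The extra colour records no residue but forces depth [k], hence the disjunction. *)
Lemma tree_color_inj x y : tree_color x = tree_color y ->
  rank_label x = rank_label y /\ (h x = h y \/ (h x)./2 = (h y)./2 %[mod k.+1]).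
Proof.
have bx := ltn_pmod (h x)./2 (ltn0Sn k); have b_y := ltn_pmod (h y)./2 (ltn0Sn k).
rewrite /tree_color; case: ltnP => lx; case: ltnP => ly.
- move=> eqc; have q0 : 0 < q.-1 by lia.
  have eqm : (h x)./2 %% k.+1 = (h y)./2 %% k.+1.
    move/(congr1 (divn^~ q.-1)): eqc.
    by rewrite !divnMDl // !divn_small // !addn0.
  by split; [move: eqc; rewrite eqm => /addnI | right].
- by nia.
- by nia.
- have [-> ->] := rank_label_max _ lx; have [-> ->] := rank_label_max _ ly.
  by split=> //; left.
Qed.

Lemma tree_color_distance x y :
  at_distance e x y k.*2 -> tree_color x <> tree_color y.
Proof.
move=> dxy /tree_color_inj [eql eqh].
have [i [j [ij ix jy eqij]]] := distance_meet _ _ _ dxy.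
have hij : h x - i = h y - j by rewrite -!depth_iter ?eqij.
have hxy : h x = h y.
  case: eqh => // /eqP eqm; clear dxy eql.
  wlog le : x y i j ij ix jy eqij hij eqm / h x <= h y.
    move=> W; have [le|/ltnW le] := leqP (h x) (h y); first exact: (W x y i j).
    by apply/esym; apply: (W y x j i) => //; rewrite 1?addnC // eq_sym.
  move: eqm; rewrite eq_sym eqn_mod_dvd; last by apply: half_leq.
  (* The depths differ by [j - i = 2(k - i)]. A multiple of [k.+1] that is at most [k] vanishes. *)
  have -> : (h y)./2 - (h x)./2 = k - i by lia.
  case: (posnP (k - i)) => [ki|ki /(dvdn_leq ki)]; lia.
have ik : i = k by lia.
have jk : j = k by lia.
subst i j.
have kE : k = k.-1.+1 by rewrite prednK.
have pk z : p (iter k.-1 p z) = iter k p z by rewrite [in RHS]kE.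
have /sibling_rank_inj : 0 < h (iter k.-1 p x) by rewrite depth_iter; lia.
move=> /(_ (iter k.-1 p y)) inj.
(* Equal labels would make the ancestors one level lower coincide, giving a walk of length
   [2k - 2]. *)
have /meet_walk : iter k.-1 p x = iter k.-1 p y.
  apply: inj.
  - by rewrite !depth_iter ?hxy //; lia.
  - by rewrite !pk.
  - by move: eql; rewrite /rank_label !ltnNge ix jy.
move=> /(_ ltac:(lia) ltac:(lia)) /(dxy.2); lia.
Qed.

End Rooted.

Theorem mainTheorem10 (q d : nat) (V : eqType) (e : rel V)
    (hq : 3 <= q) (hd : 0 < d) (hd_even : ~~ odd d)
    (hT : regular_tree e q) :
  exists k : nat,
    is_distance_chromatic_number e d k /\ k <= (q - 1) * (d + 1).
Proof.
have [simpE conn acyc /choice [nb nb_spec]] := hT.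
have [h [p root_hp]] := rooting_exists _ _ simpE conn acyc.
have dE : d = (d./2).*2 by rewrite even_halfK.
have k_gt0 : 0 < d./2 by lia.
have col : distance_colorable e d ((q - 1) * (d + 1)).
  have bound x : tree_color V h p q nb d./2 x < (q - 1) * (d + 1).
    (* The slack between the two bounds is [(q - 1) * d./2 - 1]. *)
    have := tree_color_lt V h p q nb d./2 k_gt0 hq x; nia.
  exists (fun x => Ordinal (bound x)) => x y dxy /(congr1 val) /=.
  rewrite dE in dxy.
  exact: (tree_color_distance V e h p simpE.1 root_hp q nb nb_spec).
have [k colk mink] : exists2 k, distance_colorable e d k
    & forall n, distance_colorable e d n -> k <= n.
  by apply: ex_least; exists ((q - 1) * (d + 1)).
by exists k; split=> //; apply: mink.
Qed.
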